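(* Let $1<p<\infty$ and $C>0$, and let $\mathcal{X}$ be a complex Banach space that is $p$-LWP($C$), i.e. satisfies the lower $p$-weak parallelogram law with constant $C$. Let $\mathcal{M},\mathcal{N}\subseteq\mathcal{X}$ be subsets and let $A:\mathcal{M}\to\mathcal{X}$, $B:\mathcal{N}\to\mathcal{X}$ be (arbitrary) maps. Let $x\in\mathcal{M}\cap\mathcal{N}$ and $a,b\in\mathbb{C}$. Then for every $\phi\in\mathcal{X}^*$ satisfying $\|\phi\|\le 1$ and $\phi(x)=0$, $$\Delta_x(A,a)^p+\Delta_x(B,b)^p\ \ge\ \frac{1}{2^{p-1}}\left(|\phi((A+B)x)|^p+C\,|\phi((A-B)x)|^p\right).$$
   Context: Let $C>0$ and $1<p<\infty$. A Banach space $\mathcal{X}$ satisfies the lower $p$-weak parallelogram law with constant $C$ (written: $\mathcal{X}$ is $p$-LWP($C$)) if $$\|x+y\|^p+C\|x-y\|^p\le 2^{p-1}\left(\|x\|^p+\|y\|^p\right),\qquad \forall x,y\in\mathcal{X}.$$ $\mathcal{X}^*$ is the space of bounded linear functionals on $\mathcal{X}$ with the operator norm. The maps $A,B$ need not be linear, Lipschitz or continuous. For $A:\mathcal{M}\to\mathcal{X}$, $x\in\mathcal{M}$ and $a\in\mathbb{C}$, the uncertainty of $A$ at $x$ relative to $a$ is $\Delta_x(A,a):=\|Ax-ax\|$ (similarly for $B$ on $\mathcal{N}$). For $x\in\mathcal{M}\cap\mathcal{N}$, $(A\pm B)x:=Ax\pm Bx$. *)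

(* Defs.v *)
From HB Require Import structures.
From mathcomp Require Import all_boot all_order all_algebra.
From mathcomp Require Import all_classical all_reals all_analysis.
From mathcomp Require Import complex.

Set Implicit Arguments.
Unset Strict Implicit.
Unset Printing Implicit Defensive.

Import Order.TTheory GRing.Theory Num.Theory.
Import numFieldNormedType.Exports.

Local Open Scope classical_set_scope.
Local Open Scope ring_scope.

(* The norm of a normed space over R[i] is valued in R[i], with zero imaginary
   part; [rnorm] is the same norm with values in R. On R[i]^o it is the
   modulus. *)
Definition rnorm (R : realType) (V : normedModType R[i]) (v : V) : R :=
  complex.Re `|v|.

Definition LWP (R : realType) (X : normedModType R[i]) (p C : R) : Prop :=
  forall x y : X,
    rnorm (x + y) `^ p + C * rnorm (x - y) `^ p
      <= 2 `^ (p - 1) * (rnorm x `^ p + rnorm y `^ p).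

Definition bounded_functional (R : realType) (X : normedModType R[i])
    (phi : {linear X -> R[i]^o}) : Prop :=
  exists K : R, forall x : X, rnorm (phi x) <= K * rnorm x.

(* The supremum is meaningful only for bounded functionals: [sup] is 0 on a set
   which is not bounded above. *)
Definition op_norm (R : realType) (X : normedModType R[i])
    (phi : {linear X -> R[i]^o}) : R :=
  sup [set rnorm (phi x) | x in [set x : X | rnorm x <= 1]].

(* A subset M used as a type stands for {x : X | x \in M}, so that A is a map
   defined on M only. *)
Definition uncertainty (R : realType) (X : normedModType R[i]) (M : set X)
    (A : M -> X) (x : M) (a : R[i]) : R :=
  rnorm (A x - a *: val x).

(* Main.v *)
(* Since phi x = 0, phi does not distinguish A x and B x from u = A x - a x and
   v = B x - b x. As phi is a contraction, |phi (u + v)| and |phi (u - v)| are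
   bounded by the norms of u + v and u - v, and the parallelogram law for u and
   v concludes. *)

Require Import Defs.
From HB Require Import structures.
From mathcomp Require Import all_boot all_order all_algebra.
From mathcomp Require Import all_classical all_reals all_analysis.
From mathcomp Require Import complex.
Import Order.TTheory GRing.Theory Num.Theory.
Import numFieldNormedType.Exports.
Local Open Scope classical_set_scope.
Local Open Scope ring_scope.

Lemma normE (R : realType) (V : normedModType R[i]) (v : V) :
  `|v| = (rnorm v)%:C%C.
Proof. by rewrite RRe_real // normr_real. Qed.

Lemma rnorm_ge0 (R : realType) (V : normedModType R[i]) (v : V) : 0 <= rnorm v.
Proof. by rewrite -lecR -normE normr_ge0. Qed.

(** Real scalars suffice: the only use is to rescale a vector to norm 1. *)
Lemma rnormZ (R : realType) (V : normedModType R[i]) (r : R) (v : V) :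
  rnorm (r%:C%C *: v) = `|r| * rnorm v.
Proof.
by apply: complexI; rewrite -normE normrZ normc_def /= expr0n addr0 sqrtr_sqr
  rmorphM /= normE.
Qed.

Lemma rnorm_eq0 (R : realType) (V : normedModType R[i]) (v : V) :
  (rnorm v == 0) = (v == 0).
Proof. by rewrite -(normr_eq0 v) normE -(inj_eq (@complexI R)). Qed.

(** A nonzero [v] rescales into the unit ball, where the supremum bounds the modulus of [phi];
    boundedness of [phi] makes that supremum a genuine upper bound. *)
Lemma op_norm_bound (R : realType) (X : normedModType R[i])
    (phi : {linear X -> R[i]^o}) (phi_bounded : bounded_functional phi) (v : X) :
  rnorm (phi v) <= op_norm phi * rnorm v.
Proof.
have [->|v_neq0] := eqVneq v 0.
  by rewrite linear0 /rnorm !normr0 mulr0.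
have v_gt0 : 0 < rnorm v by rewrite lt_def rnorm_eq0 v_neq0 rnorm_ge0.
(* The inverse is put under an absolute value so that [rnormZ] can absorb it into the argument of
   [phi]. *)
rewrite -ler_pdivrMr// mulrC -(ger0_norm (ltW _ : 0 <= (rnorm v)^-1)) ?invr_gt0//.
rewrite -rnormZ -linearZ; apply: ub_le_sup; last first.
  by exists ((rnorm v)^-1%:C%C *: v) => //=;
    rewrite rnormZ ger0_norm ?invr_ge0 ?rnorm_ge0// mulVf ?gt_eqF.
have [K phiK] := phi_bounded.
(* The sign of [K] is unknown, and [K] is negative only on the zero space; its absolute value bounds
   [phi] on the unit ball in every case. *)
exists `|K| => _ [y /= y_le1 <-]; apply: (le_trans (phiK y)).
apply: (le_trans (ler_norm _)); rewrite normrM (ger0_norm (rnorm_ge0 _ _ y)).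
by rewrite ler_piMr.
Qed.

Theorem theorem2p6 (R : realType) (p C : R) (hp : 1 < p) (hC : 0 < C)
    (X : completeNormedModType R[i]) (hX : LWP X p C)
    (M N : set X) (A : M -> X) (B : N -> X)
    (x : X) (xM : x \in M) (xN : x \in N) (a b : R[i])
    (phi : {linear X -> R[i]^o})
    (phi_bounded : bounded_functional phi) (phi_norm : op_norm phi <= 1)
    (phi_x : phi x = 0) :
  uncertainty A (exist _ x xM) a `^ p + uncertainty B (exist _ x xN) b `^ p
    >= 1 / 2 `^ (p - 1) *
       (rnorm (phi (A (exist _ x xM) + B (exist _ x xN))) `^ p
        + C * rnorm (phi (A (exist _ x xM) - B (exist _ x xN))) `^ p).
Proof.
set xA := exist _ x xM; set xB := exist _ x xN.
have phi_contr (v : X) : rnorm (phi v) <= rnorm v.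
  apply: le_trans (op_norm_bound _ _ _ phi_bounded v) _.
  by rewrite ler_piMl// rnorm_ge0.
have phi_pow (v : X) : rnorm (phi v) `^ p <= rnorm v `^ p.
  apply: ge0_ler_powR => //; rewrite ?nnegrE ?rnorm_ge0//.
  by rewrite ltW// (lt_trans _ hp).
set u := A xA - a *: x; set v := B xB - b *: x.
have phiu : phi u = phi (A xA) by rewrite linearB linearZ /= phi_x scaler0 subr0.
have phiv : phi v = phi (B xB) by rewrite linearB linearZ /= phi_x scaler0 subr0.
(* Linearity isolates the two images, which are exchanged for [phi u] and [phi v] before the sum and
   difference are reassembled. *)
rewrite linearD linearB -phiu -phiv -linearD -linearB div1r.
(* With the power of 2 moved across, the right side is the upper bound of [hX] at [u] and [v]. *)
rewrite ler_pdivrMl ?powR_gt0//.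
apply: le_trans (hX u v).
by rewrite lerD// ler_wpM2l// ltW.
Qed.
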